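(* Let $\lambda>-1$, $t\in\mathbb{R}$ and let $m\ge2$ be an integer. For $\kappa>-1$ let $\{P_n(x;\kappa)\}_{n\ge0}$ be the monic polynomials orthogonal with respect to the weight $|x|^{2\kappa+1}\exp(tx^2-x^{2m})$ on $\mathbb{R}$. Then for each $n\ge1$ $$P_{2n+1}(x;\lambda)=P_{2n+1}(x;\lambda+1)+\beta_{2n}(\lambda+1)\,P_{2n-1}(x;\lambda+1),$$ $$P_{2n}(x;\lambda)=P_{2n}(x;\lambda+1)-\frac{\beta_{2n}(\lambda)\,\beta_{2n-1}(\lambda+1)\,P_{2n-1}'(0;\lambda)}{P_{2n+1}'(0;\lambda)}\,P_{2n-2}(x;\lambda+1).$$
   Context: For each $\kappa>-1$, $\beta_n(\kappa)$ denotes the recurrence coefficient in $P_{n+1}(x;\kappa)=xP_n(x;\kappa)-\beta_n(\kappa)P_{n-1}(x;\kappa)$, $P_{-1}=0$, $P_0=1$ ($m$ and $t$ are fixed and suppressed from the notation). The prime denotes differentiation with respect to $x$. *)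

(* Defs.v *)
From HB Require Import structures.
From mathcomp Require Import all_boot all_order all_algebra.
From mathcomp Require Import all_classical all_reals all_analysis.

Set Implicit Arguments.
Unset Strict Implicit.
Unset Printing Implicit Defensive.

Import Order.TTheory GRing.Theory Num.Theory.
Import numFieldNormedType.Exports.

Local Open Scope ring_scope.

(* At x = 0 the library's [powR] is 0 for a nonzero exponent and 1 for the
   exponent 0; this single point is irrelevant for the integrals below. *)
Definition gfreud_weight (R : realType) (m : nat) (t kappa x : R) : R :=
  `|x| `^ (2 * kappa + 1) * expR (t * x ^+ 2 - x ^+ (2 * m)).

(* The integral is extended-real valued, and the library sets +oo - oo = -oo,
   so an integral that is not absolutely convergent never equals 0.  Positivity
   of the square norms is a consequence for a positive weight and is not
   required. *)
Definition monic_orthogonal (R : realType) (w : R -> R)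
    (P : nat -> {poly R}) : Prop :=
  [/\ forall n, size (P n) = n.+1,
      forall n, P n \is monic &
      forall i j, i <> j ->
        (\int[lebesgue_measure]_x ((P i).[x] * (P j).[x] * w x)%:E = 0)%E].

(* The 0 for n = 0 is the convention that the polynomial of index -1 is 0;
   hence [beta 0] is unconstrained. *)
Definition recurrence_coefficients (R : realType) (P : nat -> {poly R})
    (beta : nat -> R) : Prop :=
  P 0%N = 1 /\
  forall n, P n.+1 = 'X * P n - beta n *: (if n is k.+1 then P k else 0).

(* Main.v *)
From HB Require Import structures.
Require Import Defs.
From mathcomp Require Import all_boot all_order all_algebra.
From mathcomp Require Import all_classical all_reals all_analysis.
From mathcomp Require Import measurable_realfun zify ring lra.

(** Write [K] for the polynomials of the weight [w] of parameter [lambda] and [Q]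
    for those of the weight of parameter [lambda + 1], which is [x ^ 2 * w x].
    Everything follows from the identity [K_(2n+1) = 'X * Q_(2n)]
    ([christoffel_odd]): both sides are monic, vanish at 0 and are orthogonal
    for [w] to every polynomial of degree at most [2n] vanishing at 0, and their
    difference is such a polynomial, hence is orthogonal to itself.

    The three-term recurrence of [Q] applied to ['X * Q_(2n)] is the first
    formula.  Substituting the identity in the recurrence of [K] and dividing by
    ['X] gives [K_(2n) = Q_(2n) + b_(2n) *: Q_(2n-2)], where [b] is the recurrence
    coefficient of [K].  The identity also gives [K'_(2n+1)(0) = Q_(2n)(0)], and
    the recurrence of [Q] at 0 reads [Q_(2n)(0) = - b'_(2n-1) * Q_(2n-2)(0)], so
    that the quotient in the second formula is [- b_(2n)].  It is a genuine
    quotient because the recurrence coefficients do not vanish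
    ([recurrence_neq0], [even_horner0_neq0]).

    This argument uses integration only through a linear form on polynomials
    that is definite on squares ([moment_functional]).  Its linearity requires
    finite moments, which come from the orthogonality relations: an integral
    with value 0 converges absolutely ([integrable_of_integral_eq0]), so every
    [P_n * w] with [n >= 1] is integrable, and [w] itself is dominated by a
    combination of [|P_1| * w] and [|P_2| * w] ([integrable_weight]). *)

Import Order.TTheory GRing.Theory Num.Theory.
Import numFieldNormedType.Exports.

Set Implicit Arguments.
Unset Strict Implicit.

Local Open Scope ring_scope.

(** * Orthogonality with respect to a linear form *)

(** A sequence of monic polynomials with one member in each degree is a basis
    adapted to the degree; as an induction principle this serves both
    integrability and orthogonality. *)
Lemma degree_basis_ind (F : comNzRingType) (P : nat -> {poly F})
    (C : {poly F} -> Prop) (n : nat) :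
  (forall k, size (P k) = k.+1) -> (forall k, P k \is monic) ->
  C 0 -> (forall c p q, C p -> C q -> C (c *: p + q)) ->
  (forall k, (k < n)%N -> C (P k)) ->
  forall q : {poly F}, (size q <= n)%N -> C q.
Proof.
move=> sizeP monP C0 Clin; elim: n => [|n IHn] CP q.
  by rewrite leqn0 size_poly_eq0 => /eqP ->.
move=> szq; rewrite -[q](subrKC (q`_n *: P n)).
apply: Clin; first exact: CP.
apply: IHn => [k kn|]; first exact/CP/ltnW.
apply/leq_sizeP => j; rewrite leq_eqVlt => /orP[/eqP <-|nj].
  rewrite coefB coefZ -[X in _ * (P n)`_X]/n.+1.-1 -(sizeP n).
  by move/monicP: (monP n); rewrite /lead_coef => ->; rewrite mulr1 subrr.
have qj := leq_trans szq nj.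
by rewrite coefB coefZ (nth_default _ qj) [(P n)`_j]nth_default ?sizeP //
           mulr0 subr0.
Qed.

Lemma orthogonal_lower_degree (F : comNzRingType) (L : {scalar {poly F}})
    (P : nat -> {poly F}) :
  (forall k, size (P k) = k.+1) -> (forall k, P k \is monic) ->
  (forall i j, i <> j -> L (P i * P j) = 0) ->
  forall (n : nat) (q : {poly F}), (size q <= n)%N -> L (P n * q) = 0.
Proof.
move=> sizeP monP orthP n.
apply: (@degree_basis_ind _ P (fun q => L (P n * q) = 0)) => //.
- by rewrite mulr0 linear0.
- move=> c p q Lp Lq.
  by rewrite mulrDr linearD -scalerAr linearZ /= Lp Lq mulr0 addr0.
- by move=> k kn; apply: orthP => nk; rewrite nk ltnn in kn.
Qed.

(** * The three-term recurrence *)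

Lemma recurrenceSS (R : realType) (P : nat -> {poly R}) (beta : nat -> R) :
  recurrence_coefficients P beta ->
  forall n : nat, P n.+2 = 'X * P n.+1 - beta n.+1 *: P n.
Proof. by case=> _ PS n; rewrite PS. Qed.

Lemma recurrence1 (R : realType) (P : nat -> {poly R}) (beta : nat -> R) :
  recurrence_coefficients P beta -> P 1%N = 'X.
Proof. by case=> P0 ->; rewrite P0 mulr1 scaler0 subr0. Qed.

Lemma horner0_SS (R : realType) (P : nat -> {poly R}) (beta : nat -> R) :
  recurrence_coefficients P beta ->
  forall n : nat, (P n.+2).[0] = - beta n.+1 * (P n).[0].
Proof. by move=> rec n; rewrite (recurrenceSS rec) !hornerE mulNr. Qed.

(** By the factor theorem this makes the odd polynomials divisible by ['X]. *)
Lemma odd_horner0 (R : realType) (P : nat -> {poly R}) (beta : nat -> R) :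
  recurrence_coefficients P beta ->
  forall n : nat, (P (2 * n).+1).[0] = 0.
Proof.
move=> rec; elim=> [|n IHn]; first by rewrite (recurrence1 rec) hornerX.
by rewrite mulnS (horner0_SS rec) IHn mulr0.
Qed.

Lemma even_horner0_neq0 (R : realType) (P : nat -> {poly R}) (beta : nat -> R) :
  recurrence_coefficients P beta ->
  (forall k, beta k.+1 != 0) -> forall n : nat, (P (2 * n)%N).[0] != 0.
Proof.
move=> rec beta0; elim=> [|n IHn].
  by case: rec => -> _; rewrite hornerE oner_eq0.
by rewrite mulnS (horner0_SS rec) mulf_neq0 ?oppr_eq0.
Qed.

(** If [beta_(n+1) = 0] then [P_(n+2) = 'X * P_(n+1)], and moving the factor ['X]
    to the other side of [L (P_(n+2) * P_n) = 0] turns it into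
    [L (P_(n+1) * P_(n+1)) = 0]. *)
Lemma recurrence_neq0 (R : realType) (P : nat -> {poly R}) (beta : nat -> R)
    (L : {scalar {poly R}}) :
  recurrence_coefficients P beta ->
  (forall i j, i <> j -> L (P i * P j) = 0) ->
  (forall n, P n != 0) -> (forall p, L (p * p) = 0 -> p = 0) ->
  forall n, beta n.+1 != 0.
Proof.
move=> rec orthP Pn0 Ldef n; apply/negP => /eqP bn.
have /negP := Pn0 n.+1; apply; apply/eqP/Ldef.
have : L (P n.+2 * P n) = 0 by apply: orthP; lia.
rewrite (recurrenceSS rec) bn scale0r subr0.
case: (rec) => _ /(_ n) PS.
have XP : 'X * P n = P n.+1 + beta n *: (if n is k.+1 then P k else 0).
  by rewrite PS subrK.
rewrite mulrAC XP mulrC mulrDr linearD -scalerAr linearZ /=.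
suff -> : L (P n.+1 * (if n is k.+1 then P k else 0)) = 0.
  by rewrite mulr0 addr0.
by case: (n) => [|k]; [rewrite mulr0 linear0 | apply: orthP; lia].
Qed.

(** * Multiplying the weight by the square of the variable *)

(** The difference [D] of the two sides is [E * 'X] with [E] of degree less than
    [2n].  Then [L (K_(2n+1) * D) = 0] because [D] has degree at most [2n], and
    [L ('X * Q_(2n) * D) = L' (Q_(2n) * E) = 0]; hence [L (D * D) = 0]. *)
Lemma christoffel_odd (R : realType) (L L' : {scalar {poly R}})
    (K Q : nat -> {poly R}) (b : nat -> R) :
  (forall p, L' p = L ('X * 'X * p)) ->
  (forall p, L (p * p) = 0 -> p = 0) ->
  (forall k, size (K k) = k.+1) -> (forall k, K k \is monic) ->
  (forall k, size (Q k) = k.+1) -> (forall k, Q k \is monic) ->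
  (forall i j, i <> j -> L (K i * K j) = 0) ->
  (forall i j, i <> j -> L' (Q i * Q j) = 0) ->
  recurrence_coefficients K b ->
  forall n, K (2 * n).+1 = 'X * Q (2 * n)%N.
Proof.
move=> L'E Ldef szK monK szQ monQ orthK orthQ recK n.
apply/eqP; rewrite -subr_eq0; apply/eqP/Ldef; set D := _ - _.
have szD : (size D <= (2 * n).+1)%N.
  apply/leq_sizeP => j; rewrite leq_eqVlt => /orP[/eqP <-|nj].
    rewrite coefB coefXM /=.
    move/monicP: (monK (2 * n).+1); rewrite /lead_coef szK /= => ->.
    move/monicP: (monQ (2 * n)%N); rewrite /lead_coef szQ /= => ->.
    by rewrite subrr.
  case: j nj => // j nj.
  by rewrite coefB coefXM /= !nth_default ?szK ?szQ ?subrr.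
have /factor_theorem[E DE] : root D 0.
  by rewrite /root !hornerE (odd_horner0 recK) subrr.
rewrite subr0 in DE.
have szE : (size E <= 2 * n)%N.
  have [->|E0] := eqVneq E 0; first by rewrite size_poly0.
  by move: szD; rewrite DE size_mulX.
rewrite {1}/D mulrBl linearB /= (@orthogonal_lower_degree _ L K) //.
have -> : 'X * Q (2 * n)%N * D = 'X * 'X * (Q (2 * n)%N * E) by rewrite DE; ring.
by rewrite -L'E (@orthogonal_lower_degree _ L' Q) // subr0.
Qed.

(** * Integrals against a positive weight *)

(** If the positive or the negative part had infinite integral, the integral
    would be infinite, since [+oo - oo = -oo]. *)
Lemma integrable_of_integral_eq0 (R : realType) (d : measure_display)
    (T : measurableType d) (mu : {measure set T -> \bar R}) (f : T -> \bar R) :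
  measurable_fun setT f -> (\int[mu]_x f x = 0)%E -> mu.-integrable setT f.
Proof.
move=> mf int0.
have mfp := measurable_funepos mf; have mfn := measurable_funeneg mf.
apply/integrableP; split => //.
have -> : (fun x => `|f x|)%E = (fun x => f^\+ x + f^\- x)%E.
  by rewrite -[LHS]/(abse \o f) fune_abse.
rewrite ge0_integralD //.
move: int0; rewrite integralE.
have : (0 <= \int[mu]_x f^\+ x)%E by exact: integral_ge0.
have : (0 <= \int[mu]_x f^\- x)%E by exact: integral_ge0.
case: (\int[mu]_x f^\+ x)%E => [a| |] //;
  case: (\int[mu]_x f^\- x)%E => [b| |] //.
by rewrite -EFinD ltry.
Qed.

Lemma finite_set_root (R : idomainType) (p : {poly R}) :
  p != 0 -> finite_set [set x | p.[x] = 0]%classic.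
Proof.
move: {2}(size p) (leqnn (size p)) => n; elim: n p => [|n IHn] p.
  by rewrite leqn0 size_poly_eq0 => ->.
move=> szp p0.
have [[a pa]|noroot] := pselect (exists a, p.[a] = 0); last first.
  by apply: sub_finite_set (finite_set0 _) => x /= px; apply: noroot; exists x.
have /factor_theorem[q pE] : root p a by rewrite /root pa.
have q0 : q != 0 by apply: contraNneq p0 => q0; rewrite pE q0 mul0r.
have szq : (size q <= n)%N.
  by move: szp; rewrite pE size_Mmonic ?monicXsubC // size_XsubC addn2.
apply: (@sub_finite_set _ _ ([set a] `|` [set x | q.[x] = 0])%classic).
  move=> x /=; rewrite pE !hornerE => /eqP; rewrite mulf_eq0 subr_eq0.
  by move=> /orP[/eqP|/eqP]; [right|left].
by rewrite finite_setU; split; [exact: finite_set1|exact: IHn].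
Qed.

Definition positive_weight (R : realType) (w : R -> R) : Prop :=
  [/\ measurable_fun setT w, forall x, 0 <= w x & forall x, x != 0 -> 0 < w x].

Lemma measurable_polyM (R : realType) (w : R -> R) (p : {poly R}) :
  measurable_fun setT w ->
  measurable_fun setT (fun x => (p.[x] * w x)%:E).
Proof.
move=> mw; apply/measurable_EFinP.
by apply: measurable_funM => //; exact: measurable_poly.
Qed.

(** A zero integral would make [p * w] vanish almost everywhere, whereas it can
    vanish only at 0 and at the roots of [p], that is, on a null set. *)
Lemma integral_nonneg_poly_neq0 (R : realType) (w : R -> R) (p : {poly R}) :
  positive_weight w -> p != 0 -> (forall x, 0 <= p.[x]) ->
  (\int[lebesgue_measure]_x (p.[x] * w x)%:E <> 0)%E.
Proof.
move=> [mw w0 wgt0] p0 pge0 int0.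
have mpw := measurable_polyM p mw.
have /(ae_eq_integral_abs lebesgue_measure measurableT mpw) aepw :
    (\int[lebesgue_measure]_(x in setT) `|(p.[x] * w x)%:E| = 0)%E.
  rewrite -int0; apply: eq_integral => x _.
  by rewrite gee0_abs // lee_fin mulr_ge0.
have fin0 : finite_set [set x | (p * 'X).[x] = 0]%classic.
  by apply: finite_set_root; rewrite mulf_neq0 // polyX_eq0.
have cnt0 := countable_lebesgue_measure0 (finite_set_countable fin0).
have neg0 : (@lebesgue_measure R).-negligible [set x | (p * 'X).[x] = 0]%classic.
  by exists [set x | (p * 'X).[x] = 0]%classic; split => //;
     exact/countable_measurable/finite_set_countable.
have negT := negligibleU aepw neg0.
have /negligibleP : (@lebesgue_measure R).-negligible [set: R].
  apply: negligibleS negT => x _.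
  have [px0|px0] := pselect ((p * 'X).[x] = 0); [by right|left].
  move=> /= /(_ I) -[] /eqP; rewrite mulf_eq0 => /orP[/eqP px|/eqP wx].
    by apply: px0; rewrite hornerM px mul0r.
  apply: px0; rewrite hornerM hornerX.
  have [->|/wgt0] := eqVneq x 0; first by rewrite mulr0.
  by rewrite wx ltxx.
move=> /(_ measurableT); have := lebesgue_measure_itv (`]-oo, +oo[ : interval R).
by rewrite set_itvE /= => ->.
Qed.

Lemma integrable_linear_comb (R : realType) (w : R -> R) (c : R)
    (p q : {poly R}) :
  lebesgue_measure.-integrable setT (fun x => (p.[x] * w x)%:E) ->
  lebesgue_measure.-integrable setT (fun x => (q.[x] * w x)%:E) ->
  lebesgue_measure.-integrable setT (fun x => ((c *: p + q).[x] * w x)%:E).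
Proof.
move=> ip iq.
have := integrableD measurableT (integrableZl measurableT c ip) iq.
apply: eq_integrable => // x _ /=.
by rewrite hornerD hornerZ mulrDl -mulrA EFinD EFinM.
Qed.

(** Since [P_1 = 'X] and [P_2 = 'X ^ 2 - b] with [b = beta_1], and [P_2 * w] has
    integral 0, positivity forces [b > 0].  The polynomials [P_1] and [P_2] then
    have no common root, so that a combination of their absolute values is
    bounded below by a positive constant. *)
Lemma integrable_weight (R : realType) (w : R -> R) (P : nat -> {poly R})
    (beta : nat -> R) :
  positive_weight w -> monic_orthogonal w P -> recurrence_coefficients P beta ->
  lebesgue_measure.-integrable setT (fun x => (w x)%:E).
Proof.
move=> pw orthP rec; have [mw w0 _] := pw; have [szP monP orth] := orthP.
have iP n : lebesgue_measure.-integrable setT (fun x => ((P n.+1).[x] * w x)%:E).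
  apply: integrable_of_integral_eq0; first exact: measurable_polyM.
  by rewrite -[RHS](orth n.+1 0%N) //; apply: eq_integral => x _;
     rewrite (proj1 rec) hornerE mulr1.
have P1E := recurrence1 rec.
have P2E : P 2%N = 'X * 'X - (beta 1%N)%:P.
  by rewrite (recurrenceSS rec) P1E (proj1 rec) alg_polyC.
have b_gt0 : 0 < beta 1%N.
  rewrite ltNge; apply/negP => b_le0.
  apply: (@integral_nonneg_poly_neq0 _ w (P 2%N) pw).
  - by rewrite -size_poly_eq0 szP.
  - by move=> x; rewrite P2E !hornerE -expr2 addr_ge0 ?sqr_ge0 ?oppr_ge0.
  by rewrite -[RHS](orth 2%N 0%N) //; apply: eq_integral => x _;
     rewrite (proj1 rec) [(1 : {poly R}).[x]]hornerE mulr1.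
set b := beta 1%N in P2E b_gt0.
(* Any [k >= 0] with [k ^ 2 >= 2 * b] satisfies [b <= k * |x| + |x ^ 2 - b|]:
   where [|x| <= k] one has [x ^ 2 <= k * |x|], and elsewhere [x ^ 2 - b >= b]. *)
pose k := (1 + 2 * b).
have idom : lebesgue_measure.-integrable setT
   (fun x => ((k / b)%:E * `|((P 1%N).[x] * w x)%:E| +
              b^-1%:E * `|((P 2%N).[x] * w x)%:E|)%E).
  apply: integrableD => //.
    by apply: integrableZl => //; exact: integrable_abse (iP 0%N).
  by apply: integrableZl => //; exact: integrable_abse (iP 1%N).
apply: le_integrable idom => //; first exact/measurable_EFinP.
move=> x _; move: (x : R) => {}x /=.
have P2x : (P 2%N).[x] = x * x - b by rewrite P2E !hornerE.
rewrite lee_fin !normrM (ger0_norm (w0 x)) P1E hornerX P2x.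
apply: le_trans (ler_norm _).
have -> : k / b * (`|x| * w x) + b^-1 * (`|x * x - b| * w x) =
          (k * `|x| + `|x * x - b|) / b * w x by ring.
rewrite ler_peMl // ler_pdivlMr // mul1r.
have -> : x * x = `|x| * `|x| by rewrite -!expr2 real_normK ?num_real.
have := normr_ge0 x; move: `|x| => y y0.
have kE : k = 1 + 2 * b by [].
clearbody k; have [yk|ky] := lerP y k.
  have : y * y <= k * y by apply: ler_wpM2r.
  have := ler_norm (- (y * y - b)); rewrite normrN; lra.
have : k * k <= y * y by apply: ler_pM; lra.
have : 0 <= k * y by apply: mulr_ge0 => //; lra.
have := ler_norm (y * y - b); rewrite kE; nra.
Qed.

Lemma integrable_poly (R : realType) (w : R -> R) (P : nat -> {poly R})
    (beta : nat -> R) :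
  positive_weight w -> monic_orthogonal w P -> recurrence_coefficients P beta ->
  forall p : {poly R},
  lebesgue_measure.-integrable setT (fun x => (p.[x] * w x)%:E).
Proof.
move=> pw orthP rec p; have [mw _ _] := pw; have [szP monP orth] := orthP.
apply: (@degree_basis_ind _ P (fun p => lebesgue_measure.-integrable setT
  (fun x => (p.[x] * w x)%:E)) (size p)) => //.
- apply: eq_integrable (integrable0 _ _) => // x _.
  by rewrite hornerE mul0r.
- by move=> c q r; exact: integrable_linear_comb.
- move=> [|n] _.
    by apply: eq_integrable (integrable_weight pw orthP rec) => // x _;
       rewrite (proj1 rec) hornerE mul1r.
  apply: integrable_of_integral_eq0; first exact: measurable_polyM.
  by rewrite -[RHS](orth n.+1 0%N) //; apply: eq_integral => x _;
     rewrite (proj1 rec) hornerE mulr1.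
Qed.

Lemma moment_functional (R : realType) (w : R -> R) (P : nat -> {poly R})
    (beta : nat -> R) :
  positive_weight w -> monic_orthogonal w P -> recurrence_coefficients P beta ->
  exists L : {scalar {poly R}},
    [/\ forall p, L p = \int[lebesgue_measure]_x (p.[x] * w x),
        forall p, L (p * p) = 0 -> p = 0 &
        forall i j, i <> j -> L (P i * P j) = 0].
Proof.
move=> pw orthP rec; have ip := integrable_poly pw orthP rec.
pose f (p : {poly R}) := \int[lebesgue_measure]_x (p.[x] * w x).
have f_linear : scalar f.
  move=> c p q; have icp := integrable_poly pw orthP rec (c *: p).
  transitivity (\int[lebesgue_measure]_x ((c *: p).[x] * w x + q.[x] * w x)).
    by apply: eq_Rintegral => x _; rewrite hornerD mulrDl.
  rewrite (RintegralD measurableT icp (ip q)); congr (_ + _).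
  rewrite -[RHS](RintegralZl c measurableT (ip p)).
  by apply: eq_Rintegral => x _; rewrite hornerZ mulrA.
pose L : {scalar {poly R}} := HB.pack f (GRing.isLinear.Build _ _ _ _ f f_linear).
have LE p : L p = \int[lebesgue_measure]_x (p.[x] * w x) by [].
exists L; split => // [p|i j ij].
  rewrite LE => Lpp; apply/eqP/negPn/negP => p0.
  apply: (@integral_nonneg_poly_neq0 _ w (p * p) pw).
  - by rewrite mulf_neq0.
  - by move=> x; rewrite hornerM -expr2 sqr_ge0.
  rewrite -[LHS]fineK; last exact: integrable_fin_num (ip _).
  by rewrite -[X in X%:E]/(Rintegral _ _ _) Lpp.
case: orthP => _ _ /(_ i j ij) int0.
rewrite LE /Rintegral (_ : (\int[lebesgue_measure]_x _)%E = 0%E) //.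
by rewrite -[RHS]int0; apply: eq_integral => x _; rewrite hornerM.
Qed.

(** * The generalized Freud weight *)

Lemma gfreud_weight_positive (R : realType) (m : nat) (t kappa : R) :
  positive_weight (gfreud_weight m t kappa).
Proof.
split.
- apply: measurable_funM.
    exact: (measurableT_comp (measurable_powR (2 * kappa + 1))
              (@normr_measurable R setT)).
  have -> : (fun x => expR (t * x ^+ 2 - x ^+ (2 * m))) =
            expR \o horner (t *: 'X^2 - 'X^(2 * m)).
    by apply/funext => x /=; rewrite !hornerE.
  apply: measurableT_comp; first exact: measurable_expR.
  exact: measurable_poly.
- by move=> x; rewrite mulr_ge0 ?powR_ge0 ?expR_ge0.
- by move=> x x0; rewrite mulr_gt0 ?expR_gt0 // powR_gt0 // normr_gt0.
Qed.

(** At [x = 0] the left-hand side vanishes because its exponent is positive,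
    which is where [-1 < kappa] enters. *)
Lemma gfreud_weight_shift (R : realType) (m : nat) (t kappa x : R) :
  -1 < kappa ->
  gfreud_weight m t (kappa + 1) x = x * x * gfreud_weight m t kappa x.
Proof.
move=> hk; rewrite /gfreud_weight mulrA; congr (_ * _).
have [->|x0] := eqVneq x 0.
  by rewrite normr0 powR0 ?mulr0 ?mul0r //; apply: lt0r_neq0; lra.
have -> : 2 * (kappa + 1) + 1 = 2%:R + (2 * kappa + 1) by ring.
rewrite powRD; last by rewrite normr_eq0 x0 implybT.
by rewrite powR_mulrn // real_normK ?num_real // expr2.
Qed.

Unset Implicit Arguments.
Set Strict Implicit.

(** * The connection formulas *)

Theorem theorem5p3 (R : realType) (lambda t : R) (m : nat)
    (P : R -> nat -> {poly R}) (beta : R -> nat -> R)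
    (hlambda : -1 < lambda) (hm : (2 <= m)%N)
    (hP : forall kappa : R, -1 < kappa ->
      monic_orthogonal (gfreud_weight m t kappa) (P kappa))
    (hbeta : forall kappa : R, -1 < kappa ->
      recurrence_coefficients (P kappa) (beta kappa))
    (n : nat) (hn : (1 <= n)%N) :
  P lambda (2 * n + 1)%N =
    P (lambda + 1) (2 * n + 1)%N
    + beta (lambda + 1) (2 * n)%N *: P (lambda + 1) (2 * n - 1)%N
  /\
  P lambda (2 * n)%N =
    P (lambda + 1) (2 * n)%N
    - (beta lambda (2 * n)%N * beta (lambda + 1) (2 * n - 1)%N
         * (P lambda (2 * n - 1)%N)^`().[0]
       / (P lambda (2 * n + 1)%N)^`().[0])
      *: P (lambda + 1) (2 * n - 2)%N.
Proof.
have hlambda1 : -1 < lambda + 1 by lra.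
have [L [LE Ldef Lorth]] := moment_functional
  (gfreud_weight_positive m t lambda) (hP _ hlambda) (hbeta _ hlambda).
have [L' [L'E L'def L'orth]] := moment_functional
  (gfreud_weight_positive m t (lambda + 1)) (hP _ hlambda1) (hbeta _ hlambda1).
have L'L p : L' p = L ('X * 'X * p).
  rewrite LE L'E; apply: eq_Rintegral => x _.
  by rewrite gfreud_weight_shift // !hornerM !hornerX; ring.
move: (hP _ hlambda) (hP _ hlambda1) (hbeta _ hlambda) (hbeta _ hlambda1).
move: (P lambda) (P (lambda + 1)) (beta lambda) (beta (lambda + 1)) Lorth L'orth.
move=> K Q b b' orthK orthQ [szK monK _] [szQ monQ _] recK recQ.
have KXQ := christoffel_odd L'L Ldef szK monK szQ monQ orthK orthQ recK.
have b'0 : forall k, b' k.+1 != 0.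
  by apply: (recurrence_neq0 recQ orthQ _ L'def) => k; rewrite -size_poly_eq0 szQ.
have Q0 := even_horner0_neq0 recQ b'0.
have dK k : (K (2 * k).+1)^`().[0] = (Q (2 * k)%N).[0].
  by rewrite KXQ derivM derivX !hornerE.
case: n hn => // n _.
have -> : (2 * n.+1 + 1 = (2 * n.+1).+1)%N by lia.
have -> : (2 * n.+1 - 1 = (2 * n).+1)%N by lia.
have -> : (2 * n.+1 - 2 = 2 * n)%N by lia.
split.
  by rewrite KXQ mulnS (recurrenceSS recQ (2 * n).+1) subrK.
have KQ : K (2 * n.+1)%N = Q (2 * n.+1)%N + b (2 * n.+1)%N *: Q (2 * n)%N.
  have /mulfI : 'X != 0 :> {poly R} by rewrite polyX_eq0.
  apply.
  have : K (2 * n.+1).+1 = 'X * K (2 * n.+1)%N - b (2 * n.+1)%N *: K (2 * n).+1.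
    by rewrite mulnS (recurrenceSS recK).
  by rewrite !KXQ mulrDr -scalerAr => ->; rewrite subrK.
rewrite !dK KQ -scaleNr; congr (_ + _ *: _).
have -> : (Q (2 * n.+1)%N).[0] = - b' (2 * n).+1 * (Q (2 * n)%N).[0].
  by rewrite mulnS (horner0_SS recQ).
by field; rewrite b'0 Q0.
Qed.
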